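(* Let $Q$ be a quantity space over $\mathbb{R}_{>0}$, let $\mathfrak{D},\mathfrak{D}_1,\ldots,\mathfrak{D}_m,\mathfrak{B}_1,\ldots,\mathfrak{B}_r$ be dimensions in $Q/{\sim}$ such that $\{\mathfrak{B}_1,\ldots,\mathfrak{B}_r\}$ is a maximal set of independent dimensions in the dimension group generated by $\mathfrak{D}_1,\ldots,\mathfrak{D}_m,\mathfrak{B}_1,\ldots,\mathfrak{B}_r$, and let $$\Psi:\mathfrak{D}_1\times\cdots\times\mathfrak{D}_m\times\mathfrak{B}_1\times\cdots\times\mathfrak{B}_r\to\mathfrak{D},\quad (p_1,\dots,p_m,q_1,\dots,q_r)\mapsto p$$ be a non-trivial quantity function with a covariant scalar representation $$\psi:\mathbb{R}_{>0}^{m+r}\to\mathbb{R}_{>0},\quad (s_1,\dots,s_m,t_1,\dots,t_r)\mapsto s.$$ Then there are integers $k>0,k_1,\ldots,k_r$ such that $\mathfrak{D}^{k}=\prod_{j=1}^r\mathfrak{B}_j^{k_j}$, and integers $c_i>0,c_{i1},\ldots,c_{ir}$ such that $\mathfrak{D}_i^{c_i}=\prod_{j=1}^r\mathfrak{B}_j^{c_{ij}}$ for $i=1,\ldots,m$, such that there is (1) a quasiscalar function $\Phi:[1_Q]\times\cdots\times[1_Q]\to[1_Q]$ ($m$ factors) such that $$p^{k}=\Psi^{k}(p_1,\dots,p_m,q_1,\dots,q_r)=\prod_{j=1}^r q_j^{k_j}\,\Phi(\Pi_1,\ldots,\Pi_m)$$ for all arguments, where $\Psi^{k}(p_1,\dots,q_r)=(\Psi(p_1,\dots,q_r))^{k}$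 and $\Pi_i=p_i^{c_i}/\bigl(\prod_{j=1}^r q_j^{c_{ij}}\bigr)$; (2) a scalar function $\phi:\mathbb{R}_{>0}^m\to\mathbb{R}_{>0}$ such that $\psi^{k}$, defined by $$s^{k}=\psi^{k}(s_1,\dots,s_m,t_1,\dots,t_r)=\prod_{j=1}^r t_j^{k_j}\,\phi(\pi_1,\ldots,\pi_m),$$ where $\pi_i=s_i^{c_i}/\bigl(\prod_{j=1}^r t_j^{c_{ij}}\bigr)$, is a covariant scalar representation of $\Psi^{k}$.
   Context: A scalable monoid over $\mathbb{R}_{>0}$ is a commutative monoid $Q$ (written multiplicatively, unit $1_Q$) with a map $\mathbb{R}_{>0}\times Q\to Q$, $(\alpha,q)\mapsto\alpha q$, such that $1q=q$, $\alpha(\beta q)=(\alpha\beta)q$, $\alpha(qq')=(\alpha q)q'$ for all $\alpha,\beta\in\mathbb{R}_{>0}$, $q,q'\in Q$. A basis for $Q$ is a finite set $B=\{b_1,\dots,b_n\}$ of invertible elements of $Q$ such that every $q\in Q$ has a unique expansion $q=\mu\prod_{i=1}^n b_i^{k_i}$ with $\mu\in\mathbb{R}_{>0}$, $k_i\in\mathbb{Z}$; the scalar $\mu$ is the measure $\mu_B(q)$ of $q$ relative to $B$. A quantity space over $\mathbb{R}_{>0}$ is a scalable monoid over $\mathbb{R}_{>0}$ with a finite basis (then every quantity is invertible). $q\sim q'$ means $\alpha q=\beta q'$ for some scalars $\alpha,\beta$; this is a congruence, its classes $[q]$ are called dimensions, and $Q/{\sim}$ with $[q][q']=[qq']$ is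 a free abelian group of finite rank. A dimension group is a subgroup of $Q/{\sim}$. A dimension $\mathfrak{d}$ is dependent on $\mathfrak{d}_1,\dots,\mathfrak{d}_n$ if there are integers $k\neq0,k_1,\dots,k_n$ with $\mathfrak{d}^k=\prod_{i=1}^n\mathfrak{d}_i^{k_i}$ (an empty product is $[1_Q]$). $\{\mathfrak{d}_1,\dots,\mathfrak{d}_n\}$ is a set of independent dimensions if $\prod_{i=1}^n\mathfrak{d}_i^{k_i}=[1_Q]$ implies all $k_i=0$; it is a maximal set of independent dimensions in $\mathfrak{T}$ if it is contained in $\mathfrak{T}$, is independent, and every other element of $\mathfrak{T}$ is dependent on it. A quantity function is a function $\Phi:\mathfrak{E}_1\times\cdots\times\mathfrak{E}_N\to\mathfrak{E}$ with $\mathfrak{E},\mathfrak{E}_i\in Q/{\sim}$; it is trivial if it has the form $(q_1,\dots,q_N)\mapsto0q$ (impossible over $\mathbb{R}_{>0}$), and quasiscalar if all of $\mathfrak{E},\mathfrak{E}_i$ equal $[1_Q]$. A covariant scalar representation of $\Phi$ is a function $\phi:\mathbb{R}_{>0}^N\to\mathbb{R}_{>0}$ such that $\phi(\mu_B(q_1),\dots,\mu_B(q_N))=\mu_B(\Phi(q_1,\dots,q_N))$ for all $q_i\in\mathfrak{E}_i$ and every basis $B$ for $Q$. *)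

(* Defs.v *)
From HB Require Import structures.
From mathcomp Require Import all_boot all_order all_algebra.
From mathcomp Require Import interval_inference boolp classical_sets reals.

Set Implicit Arguments.
Unset Strict Implicit.
Unset Printing Implicit Defensive.

Import Order.TTheory GRing.Theory Num.Theory.

Local Open Scope ring_scope.

(* The scalars, R_{>0}, are {posnum R} for R : realType. *)

HB.mixin Record Monoid_isScalable (R : realType) Q of Monoid Q := {
  scaleq : {posnum R} -> Q -> Q;
  mulqC : forall p q : Q, (p * q = q * p)%g;
  scale1q : forall q : Q, scaleq 1%:pos q = q;
  scaleqA : forall (a b : {posnum R}) (q : Q),
    scaleq a (scaleq b q) = scaleq (a%:num * b%:num)%:pos q;
  scaleqAl : forall (a : {posnum R}) (p q : Q),
    scaleq a (p * q)%g = (scaleq a p * q)%g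
}.

#[short(type="scalableMonoidType")]
HB.structure Definition ScalableMonoid (R : realType) :=
  {Q of Monoid_isScalable R Q & Monoid Q}.

Declare Scope quantity_scope.
Delimit Scope quantity_scope with QS.
Notation "a *: q" := (scaleq a q) : quantity_scope.

Section IntegerPowers.
Variable M : monoidType.
Implicit Types x y : M.

Definition invertible x := exists y, (x * y = 1 /\ y * x = 1)%g.

(* The inverse of x, with junk value 1 when x is not invertible. *)
Definition minv x : M :=
  xget 1%g [set y | (x * y = 1 /\ y * x = 1)%g]%classic.

Definition zpow x (k : int) : M :=
  match k with Posz n => x ^+ n | Negz n => minv x ^+ n.+1 end%g.

End IntegerPowers.

(* The group-theoretic ^ is conjugation, hence a separate symbol for integer
   exponents. *)
Notation "x ^^ k" := (zpow x k) (at level 29, left associativity)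
  : quantity_scope.

Section Basis.
Variables (R : realType) (Q : scalableMonoidType R).

Definition expansion n (b : 'I_n -> Q) (mu : {posnum R})
    (k : {ffun 'I_n -> int}) : Q :=
  (mu *: (\prod_(i < n) (b i ^^ k i)%QS)%g)%QS.

(* A finite set {b_1, ..., b_n} is given by an enumeration; uniqueness of the
   expansions makes a repetition impossible. *)
Definition is_basis n (b : 'I_n -> Q) :=
  (forall i, invertible (b i)) /\
  (forall q : Q, exists! x : {posnum R} * {ffun 'I_n -> int},
     q = expansion b x.1 x.2).

(* Meaningful when b is a basis; the junk value is 1. *)
Definition measure n (b : 'I_n -> Q) (q : Q) : {posnum R} :=
  xget 1%:pos [set mu | exists k, q = expansion b mu k]%classic.

End Basis.

HB.mixin Record ScalableMonoid_hasFiniteBasis (R : realType) Q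
    of ScalableMonoid R Q := {
  finite_basis : exists (n : nat) (b : 'I_n -> Q), is_basis b
}.

#[short(type="quantitySpaceType")]
HB.structure Definition QuantitySpace (R : realType) :=
  {Q of ScalableMonoid_hasFiniteBasis R Q & ScalableMonoid R Q}.

Section Dimensions.
Variables (R : realType) (Q : scalableMonoidType R).
Implicit Types p q : Q.

Definition commensurable p q : bool :=
  `[< exists a b : {posnum R}, (a *: p = b *: q)%QS >].

Lemma scaleqAC (a b : {posnum R}) q : (a *: (b *: q) = b *: (a *: q))%QS.
Proof.
by rewrite !scaleqA; congr scaleq; apply: val_inj; rewrite /= mulrC.
Qed.

Lemma scaleqAr (a : {posnum R}) p q : (a *: (p * q)%g = (p * (a *: q))%g)%QS.
Proof. by rewrite mulqC scaleqAl mulqC. Qed.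

Lemma commensurable_refl : reflexive commensurable.
Proof. by move=> q; apply/asboolP; exists 1%:pos, 1%:pos. Qed.

Lemma commensurable_sym : symmetric commensurable.
Proof.
by move=> p q; apply/asboolP/asboolP => -[a [b ab]]; exists b, a.
Qed.

Lemma commensurable_trans : transitive commensurable.
Proof.
move=> q p r /asboolP[a [b ab]] /asboolP[c [d cd]]; apply/asboolP.
exists (c%:num * a%:num)%:pos, (b%:num * d%:num)%:pos.
by rewrite -!scaleqA ab scaleqAC cd.
Qed.

Canonical commensurable_equiv :=
  EquivRel commensurable commensurable_refl commensurable_sym
    commensurable_trans.

Lemma commensurableM p p' q q' :
  commensurable p p' -> commensurable q q' ->
  commensurable (p * q)%g (p' * q')%g.
Proof.
move=> /asboolP[a [b ab]] /asboolP[c [d cd]]; apply/asboolP.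
exists (a%:num * c%:num)%:pos, (b%:num * d%:num)%:pos.
by rewrite -!scaleqA (scaleqAr c) (scaleqAr d) !scaleqAl ab cd.
Qed.

Definition dimension := {eq_quot commensurable}%qT.

HB.instance Definition _ := Choice.on dimension.
HB.instance Definition _ := EqQuotient.on dimension.

Definition dim_of (q : Q) : dimension := (\pi_dimension q)%qT.

Definition dim_mul (d e : dimension) : dimension :=
  dim_of (repr d * repr e)%g.

Lemma dim_of_eq p q : (dim_of p == dim_of q) = commensurable p q.
Proof. exact: eqmodE. Qed.

Lemma dim_of_repr (d : dimension) : dim_of (repr d) = d.
Proof. exact: reprK. Qed.

Lemma dim_mulE p q : dim_mul (dim_of p) (dim_of q) = dim_of (p * q)%g.
Proof.
apply/eqP; rewrite dim_of_eq; apply: commensurableM;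
  by rewrite -dim_of_eq dim_of_repr.
Qed.

Lemma dim_mulA : associative dim_mul.
Proof.
move=> d e f; rewrite -[d]dim_of_repr -[e]dim_of_repr -[f]dim_of_repr.
by rewrite !dim_mulE mulgA.
Qed.

Lemma dim_mul1g : left_id (dim_of 1%g) dim_mul.
Proof. by move=> d; rewrite -[d]dim_of_repr dim_mulE mul1g. Qed.

Lemma dim_mulg1 : right_id (dim_of 1%g) dim_mul.
Proof. by move=> d; rewrite -[d]dim_of_repr dim_mulE mulg1. Qed.

HB.instance Definition _ :=
  isMonoid.Build dimension dim_mulA dim_mul1g dim_mulg1.

Lemma dim_ofM p q : dim_of (p * q)%g = (dim_of p * dim_of q)%g.
Proof. by rewrite -dim_mulE. Qed.

Lemma dim_ofX q n : dim_of (q ^+ n)%g = (dim_of q ^+ n)%g.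
Proof. by elim: n => // n IHn; rewrite !expgS dim_ofM IHn. Qed.

(* The dimension d as the set of its quantities. *)
Definition quantity_of (d : dimension) := {q : Q | dim_of q == d}.

Lemma quantity_ofX (d : dimension) n (q : quantity_of d) :
  dim_of (val q ^+ n)%g == (d ^+ n)%g.
Proof. by case: q => q /= /eqP <-; rewrite dim_ofX. Qed.

Definition quantity_pow (d : dimension) n (q : quantity_of d) :
    quantity_of (d ^+ n)%g :=
  exist _ (val q ^+ n)%g (quantity_ofX n q).

End Dimensions.

Coercion quantity_of : dimension >-> Sortclass.

Section DimensionGroups.
Variables (R : realType) (Q : quantitySpaceType R).
Local Notation dim := (dimension Q).

Definition dimension_group (T : set dim) :=
  [/\ T 1%g, forall d e, T d -> T e -> T (d * e)%g
    & forall d, T d -> T (minv d)].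

Definition generated_dimension_group (A : set dim) : set dim :=
  smallest dimension_group A.

Definition dependent n (d : dim) (e : 'I_n -> dim) :=
  exists (k : int) (l : 'I_n -> int),
    k != 0 /\ (d ^^ k)%QS = (\prod_(i < n) (e i ^^ l i)%QS)%g.

Definition independent n (e : 'I_n -> dim) :=
  forall l : 'I_n -> int,
    (\prod_(i < n) (e i ^^ l i)%QS)%g = 1%g -> forall i, l i = 0.

Definition maximal_independent n (T : set dim) (e : 'I_n -> dim) :=
  [/\ forall i, T (e i), independent e
    & forall d, T d -> (forall i, d <> e i) -> dependent d e].

End DimensionGroups.

Section QuantityFunctions.
Variables (R : realType) (Q : quantitySpaceType R).
Local Notation dim := (dimension Q).

Definition quantity_function N (E : 'I_N -> dim) (E0 : dim) :=
  (forall i, E i) -> E0.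

(* Over R_{>0} no quantity function is trivial, as no scalar is 0. *)
Definition trivial_function N (E : 'I_N -> dim) (E0 : dim)
    (F : quantity_function E E0) :=
  exists (a : {posnum R}) (q : E0),
    a%:num = 0 /\ forall x, val (F x) = (a *: val q)%QS.

Definition quasiscalar_function m :=
  quantity_function (fun _ : 'I_m => 1%g : dim) 1%g.

Definition function_pow N (E : 'I_N -> dim) (E0 : dim) n
    (F : quantity_function E E0) : quantity_function E (E0 ^+ n)%g :=
  fun x => quantity_pow n (F x).

Definition covariant_representation N (E : 'I_N -> dim) (E0 : dim)
    (F : quantity_function E E0)
    (f : ('I_N -> {posnum R}) -> {posnum R}) :=
  forall n (b : 'I_n -> Q), is_basis b -> forall x : (forall i, E i),
    f (fun i => measure b (val (x i))) = measure b (val (F x)).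

End QuantityFunctions.

(* The family x_1, ..., x_m, y_1, ..., y_r. *)
Definition concat (T : Type) m r (x : 'I_m -> T) (y : 'I_r -> T)
    (i : 'I_(m + r)) : T :=
  match split i with inl j => x j | inr j => y j end.

Section PositiveMonomials.
Variables (R : realType) (r : nat).

Lemma monomial_gt0 (t : 'I_r -> {posnum R}) (k : 'I_r -> int) :
  (0 < \prod_(j < r) (t j)%:num ^ k j)%R.
Proof. by apply: prodr_gt0 => j _; apply: exprz_gt0. Qed.

Definition monomial (t : 'I_r -> {posnum R}) (k : 'I_r -> int) : {posnum R} :=
  PosNum (monomial_gt0 t k).

End PositiveMonomials.

(* Main.v *)
Require Import Defs.
From HB Require Import structures.
From mathcomp Require Import all_boot all_order all_algebra.
From mathcomp Require Import interval_inference boolp classical_sets reals.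
From mathcomp Require Import sequences exp.

Set Implicit Arguments.
Unset Strict Implicit.
Unset Printing Implicit Defensive.

Import Order.TTheory GRing.Theory Num.Theory.

Local Open Scope ring_scope.

(** Fixing a basis b identifies a quantity with the logarithm of its measure and
an integer exponent vector, which is the dimension. Replacing each b_i by
exp(x_i) b_i gives another basis, and comparing the two shows that, in
logarithmic form, psi(u - A x) = psi(u) - <a0, x> for every real vector x, where
the rows of A are the exponent vectors of the D_i and B_j and a0 is that of D.

If x is orthogonal to all the B_j, then it is orthogonal to all the D_i, hence
to a0; so a0 lies in the rational span of the B_j, and clearing denominators
gives k and the k_j. As the B_j are independent, x can be chosen so that u - A x
vanishes in the last r coordinates; the first m are then log(pi_i) / c_i, and
multiplying the scaling law by k gives
psi^k(s, t) = prod_j t_j^(k_j) psi^k(pi_1^(1/c_1), ..., pi_m^(1/c_m), 1, ..., 1). *)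

(** * Integer powers of invertible monoid elements *)

Section IntegerPowerTheory.
Variable M : monoidType.
Implicit Types x y : M.

Lemma minvP x : invertible x -> (x * minv x = 1 /\ minv x * x = 1)%g.
Proof.
case=> y xy.
by apply: (@xgetPex _ 1%g [set y | x * y = 1 /\ y * x = 1]%g%classic); exists y.
Qed.

Lemma invertible_mulgI x y z : invertible x -> (x * y = x * z -> y = z)%g.
Proof. by move=> /minvP[_ Vx] e; rewrite -[y]mul1g -Vx -mulgA e mulgA Vx mul1g. Qed.

Lemma zpow1 x : (x ^^ 1)%QS = x. Proof. exact: expg1. Qed.

Lemma zpowS x k : invertible x -> (x ^^ (k + 1) = (x * (x ^^ k)%QS)%g)%QS.
Proof.
move=> /minvP[xV _]; case: k => n; first by rewrite -PoszD addn1 /= expgS.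
case: n => [|n]; first by rewrite /= expg1.
have -> : Negz n.+1 + 1 = Negz n by rewrite !NegzE -(addn1 n.+1) PoszD opprD addrNK.
by rewrite /= [in RHS]expgS mulgA xV mul1g.
Qed.

Lemma zpowD x k l : invertible x ->
  (x ^^ (k + l) = ((x ^^ k)%QS * (x ^^ l)%QS)%g)%QS.
Proof.
move=> xU; elim/int_ind: k => [|n IHn|n IHn]; first by rewrite add0r mul1g.
  by rewrite -addn1 PoszD addrAC !zpowS // IHn mulgA.
(* [zpowS] only raises the exponent, so the downward step multiplies by [x] and cancels it. *)
apply: (invertible_mulgI xU); rewrite mulgA -!zpowS //.
by rewrite -addn1 PoszD opprD addrNK addrAC addrNK.
Qed.

Lemma prod_zpow_delta n (x : 'I_n -> M) i :
  (\prod_j (x j ^^ (j == i)%:R)%QS)%g = x i.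
Proof.
rewrite (eq_bigr (fun j => if j == i then x i else 1%g)) => [|j _].
  by rewrite -big_mkcond big_pred1_eq.
by case: eqP => [->|//]; rewrite zpow1.
Qed.

End IntegerPowerTheory.

(** * Monoid maps into an additive group *)

Section AdditiveCharacters.
Variables (M : monoidType) (V : zmodType) (f : M -> V).
Hypothesis fM : forall x y, f (x * y)%g = f x + f y.

Lemma char1 : f 1%g = 0.
Proof. by apply: (addrI (f 1%g)); rewrite -fM mulg1 addr0. Qed.

Lemma charX x n : f (x ^+ n)%g = f x *+ n.
Proof. by elim: n => [|n IHn]; rewrite ?char1 // expgS fM IHn mulrS. Qed.

Lemma char_minv x : invertible x -> f (minv x) = - f x.
Proof. by case/minvP=> xV _; apply: (addrI (f x)); rewrite -fM xV char1 subrr. Qed.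

Lemma char_zpow x k : invertible x -> f (x ^^ k)%QS = f x *~ k.
Proof.
move=> xU; case: k => n; first exact: charX.
by rewrite /= charX char_minv // mulNrn NegzE mulrNz.
Qed.

Lemma char_prod n (F : 'I_n -> M) : f (\prod_i F i)%g = \sum_i f (F i).
Proof. exact: (big_morph f fM char1). Qed.

End AdditiveCharacters.

(** * Logarithms of positive scalars *)

Section PosnumLogarithm.
Variable R : realType.
Implicit Types (a b : {posnum R}) (x y : R).

Definition logp a : R := ln a%:num.
Definition expp x : {posnum R} := PosNum (expR_gt0 x).

Lemma exppK : cancel expp logp.
Proof. exact: expRK. Qed.

Lemma logpK : cancel logp expp.
Proof. by move=> a; apply: val_inj; rewrite /= lnK // posrE. Qed.

Lemma logpM a b : logp (a%:num * b%:num)%:pos = logp a + logp b.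
Proof. by rewrite /logp /= lnM // posrE. Qed.

Lemma logpX a l : logp (a%:num ^+ l)%:pos = logp a *+ l.
Proof. by rewrite /logp /= lnXn. Qed.

Lemma logpV a : logp (a%:num^-1)%:pos = - logp a.
Proof. by rewrite /logp /= lnV // posrE. Qed.

Lemma logp1 : logp 1%:pos = 0.
Proof. exact: ln1. Qed.

Lemma expr_num_logp a n : a%:num ^+ n = expR (logp a *+ n).
Proof. by rewrite -mulr_natl expRM_natl lnK // posrE. Qed.

Lemma exprz_num_logp a (k : int) : a%:num ^ k = expR (logp a *~ k).
Proof.
case: k => n; first exact: expr_num_logp.
by rewrite NegzE -exprnN expr_num_logp mulrNz expRN.
Qed.

Lemma logp_monomial r (t : 'I_r -> {posnum R}) k :
  logp (monomial t k) = \sum_j logp (t j) *~ k j.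
Proof.
rewrite /logp /monomial /=.
under eq_bigr do rewrite exprz_num_logp.
by rewrite -expR_sum expRK.
Qed.

End PosnumLogarithm.

(** * Rational spans and real solvability for integer vectors *)

Section IntegerVectors.
Variables (R : realType) (n r : nat) (beta : 'I_r -> 'I_n -> int).

(** In use, [a] is an exponent vector and [x] holds the logarithms of the factors by which the basis
    elements are rescaled. *)
Definition pairing (a : 'I_n -> int) (x : 'I_n -> R) : R := \sum_i x i *~ a i.

Lemma clear_denominators (u : 'I_r -> rat) :
  exists2 d : nat, (0 < d)%N & exists z : 'I_r -> int, forall j, u j *+ d = (z j)%:~R.
Proof.
pose d j := `|denq (u j)|%N.
exists (\prod_j d j)%N; first by apply: prodn_gt0 => j; rewrite absz_gt0 denq_neq0.
(* Over the common denominator, each numerator is multiplied by all the other denominators. *)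
exists (fun j => numq (u j) * (\prod_(i | i != j) d i)%N) => j.
rewrite (bigD1 j) //= mulrnA intrM numqE -(absz_denq (u j)) -/(d j).
by rewrite !mulrzr.
Qed.

Let Mb : 'M[rat]_(r, n) := \matrix_(j, i) (beta j i)%:~R.

Lemma pairing_span (a : 'I_n -> int) k (kj : 'I_r -> int) x :
  (forall i, a i *+ k = \sum_j beta j i *~ kj j) ->
  pairing a x *+ k = \sum_j pairing (beta j) x *~ kj j.
Proof.
move=> aE; rewrite -sumrMnl.
transitivity (\sum_i \sum_j x i *~ (beta j i *~ kj j)).
  apply: eq_bigr => i _; rewrite pmulrn -mulrzA -[Posz k]natz mulr_natr aE.
  by rewrite mulrz_sumr.
rewrite exchange_big; apply: eq_bigr => j _; rewrite mulrz_suml.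
by apply: eq_bigr => i _; rewrite mulrzz mulrzA.
Qed.

(** Orthogonality is assumed over the reals but kernels are computed over the rationals; [ratr]
    links the two. *)
Lemma pairing_ratr (b : 'I_n -> int) (w : 'I_n -> rat) :
  pairing b (fun i => ratr (w i)) = ratr (\sum_i (b i)%:~R * w i).
Proof.
by rewrite rmorph_sum; apply: eq_bigr => i _; rewrite rmorphM /= ratr_int mulrC mulrzr.
Qed.

(* If [a] is outside the rational row space of [beta], then a column of the
   cokernel of [beta] is orthogonal to every [beta j] but not to [a]. *)
Lemma rational_span (a : 'I_n -> int) :
  (forall x, (forall j, pairing (beta j) x = 0) -> pairing a x = 0) ->
  exists2 k : nat, (0 < k)%N & exists kj : 'I_r -> int,
    forall i, a i *+ k = \sum_j beta j i *~ kj j.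
Proof.
move=> ax; pose v : 'rV[rat]_n := \row_i (a i)%:~R.
have /submxP[u vE] : (v <= Mb)%MS.
  rewrite submxE; apply/eqP/rowP => l; rewrite !mxE.
  under eq_bigr do rewrite mxE.
  have := ax (fun i => ratr (cokermx Mb i l)); rewrite pairing_ratr => coker0.
  apply/eqP; rewrite -(fmorph_eq0 (ratr : {rmorphism rat -> R})).
  apply/eqP/coker0 => j.
  rewrite pairing_ratr (_ : \sum_i _ = (Mb *m cokermx Mb) j l).
    by rewrite mulmx_coker mxE rmorph0.
  by rewrite mxE; apply: eq_bigr => i _; rewrite [Mb j i]mxE.
have [k k_gt0 [kj kjE]] := clear_denominators (u ord0).
exists k => //; exists kj => i; apply: (intr_inj (R := rat)).
have /rowP/(_ i) := vE; rewrite !mxE => aE.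
rewrite rmorphMn /= aE rmorph_sum -sumrMnl; apply: eq_bigr => j _.
by rewrite mxE -mulrnAl kjE mulrzz /= intrM mulrC.
Qed.

(** Clearing denominators upgrades integral to rational independence, so [Mb] has a rational right
    inverse [N]; applying [N] to the real vector [t] solves the system. *)
Lemma integral_independence_solve (t : 'I_r -> R) :
  (forall l : 'I_r -> int,
     (forall i, \sum_j beta j i *~ l j = 0) -> forall j, l j = 0) ->
  exists x, forall j, pairing (beta j) x = t j.
Proof.
move=> beta_free; have /row_freeP[N MN] : row_free Mb.
  apply: inj_row_free => u uM; apply/rowP => j; rewrite mxE.
  have [d d_gt0 [z zE]] := clear_denominators (u ord0).
  have z0 : z j = 0.
    apply: beta_free => i; apply: (intr_inj (R := rat)).
    have /rowP/(_ i) := uM; rewrite !mxE => /(congr1 (fun y => y *+ d)).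
    rewrite mul0rn => uM0; rewrite rmorph0 -[RHS]uM0 -sumrMnl rmorph_sum.
    apply: eq_bigr => l _.
    by rewrite mxE -mulrnAl zE mulrzz /= intrM mulrC.
  by move/eqP: (zE j); rewrite z0 mulrn_eq0 -leqn0 leqNgt d_gt0 => /eqP.
exists (fun i => \sum_l ratr (N i l) * t l) => j.
rewrite /pairing; under eq_bigr do rewrite -mulrzr mulr_suml.
rewrite exchange_big /= (eq_bigr (fun l => ratr ((1%:M : 'M[rat]_r) j l) * t l)).
  rewrite (bigD1 j) //= mxE eqxx rmorph1 mul1r big1 ?addr0 // => l /negbTE jl.
  by rewrite mxE eq_sym jl rmorph0 mul0r.
move=> l _; rewrite -MN mxE rmorph_sum mulr_suml; apply: eq_bigr => i _.
by rewrite [Mb j i]mxE rmorphM /= ratr_int mulrC mulrA.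
Qed.

End IntegerVectors.

(** * Measure and exponents as coordinates in a fixed basis *)

Section Coordinates.
Variables (R : realType) (Q : quantitySpaceType R) (n : nat) (b : 'I_n -> Q).
Hypothesis b_basis : is_basis b.
Implicit Types (p q : Q) (mu : {posnum R}) (k : {ffun 'I_n -> int}).

(* Meaningful when b is a basis; the junk value is 0. *)
Definition exponent q : {ffun 'I_n -> int} :=
  xget [ffun=> 0] [set k | exists mu, q = expansion b mu k]%classic.

Lemma expansion_inj mu nu k l :
  expansion b mu k = expansion b nu l -> mu = nu /\ k = l.
Proof.
have [_ /(_ (expansion b mu k))[x [_ xU]] e] := b_basis.
have := xU (mu, k) erefl; rewrite (xU (nu, l) e).
by case.
Qed.

Lemma measure_expansion mu k : measure b (expansion b mu k) = mu.
Proof.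
rewrite /measure; case: xgetP => [nu _ /= [l /expansion_inj[]//]|/(_ mu)[]].
by exists k.
Qed.

Lemma exponent_expansion mu k : exponent (expansion b mu k) = k.
Proof.
rewrite /exponent; case: xgetP => [l _ /= [nu /expansion_inj[]//]|/(_ k)[]].
by exists mu.
Qed.

Lemma expansion_coords q : expansion b (measure b q) (exponent q) = q.
Proof.
have [_ /(_ q)[[mu k] [/= -> _]]] := b_basis.
by rewrite measure_expansion exponent_expansion.
Qed.

Lemma expansionM mu nu k l :
  (expansion b mu k * expansion b nu l)%g =
  expansion b (mu%:num * nu%:num)%:pos [ffun i => k i + l i].
Proof.
rewrite /expansion -scaleqAl -scaleqAr scaleqA; congr scaleq.
rewrite -prodgM_commute; last by move=> i j _ _; exact: Defs.mulqC.
by apply: eq_bigr => i _; rewrite ffunE zpowD //; have [] := b_basis.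
Qed.

Lemma measureM p q :
  measure b (p * q)%g = ((measure b p)%:num * (measure b q)%:num)%:pos.
Proof.
by rewrite -{1}[p]expansion_coords -{1}[q]expansion_coords expansionM measure_expansion.
Qed.

Lemma exponentM p q i : exponent (p * q)%g i = exponent p i + exponent q i.
Proof.
rewrite -{1}[p]expansion_coords -{1}[q]expansion_coords expansionM.
by rewrite exponent_expansion ffunE.
Qed.

Definition logm q : R := logp (measure b q).

Lemma logmM p q : logm (p * q)%g = logm p + logm q.
Proof. by rewrite /logm measureM logpM. Qed.

Lemma coords_inj p q : logm p = logm q -> exponent p =1 exponent q -> p = q.
Proof.
move=> /(can_inj (@logpK R)) mpq /ffunP epq.
by rewrite -[p]expansion_coords mpq epq expansion_coords.
Qed.

Lemma scaleq_expansion a mu k :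
  (a *: expansion b mu k)%QS = expansion b (a%:num * mu%:num)%:pos k.
Proof. by rewrite /expansion scaleqA. Qed.

Lemma logm_scale a q : logm (a *: q)%QS = logp a + logm q.
Proof.
by rewrite -{1}[q]expansion_coords scaleq_expansion /logm measure_expansion logpM.
Qed.

Lemma exponent_scale a q : exponent (a *: q)%QS = exponent q.
Proof. by rewrite -{1}[q]expansion_coords scaleq_expansion exponent_expansion. Qed.

Lemma basis_expansion i : b i = expansion b 1%:pos [ffun j => (j == i)%:R].
Proof.
rewrite /expansion scale1q -[LHS]prod_zpow_delta.
by apply: eq_bigr => j _; rewrite ffunE.
Qed.

Lemma logm_basis i : logm (b i) = 0.
Proof. by rewrite basis_expansion /logm measure_expansion logp1. Qed.

Lemma exponent_basis i j : exponent (b i) j = (j == i)%:R.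
Proof. by rewrite basis_expansion exponent_expansion ffunE. Qed.

(** The inverse has the opposite log measure and the opposite exponents. *)
Lemma basis_invertible q : invertible q.
Proof.
pose q' := expansion b (expp (- logm q)) [ffun i => - exponent q i].
have qq' : (q * q')%g = 1%g.
  apply: coords_inj => [|i].
    rewrite logmM {2}/logm measure_expansion exppK subrr.
    by rewrite (char1 logmM).
  rewrite exponentM exponent_expansion ffunE subrr.
  by rewrite (char1 (fun x y => exponentM x y i)).
by exists q'; split; rewrite // Defs.mulqC.
Qed.

(** Scaling changes the measure only; conversely, scaling each quantity by the measure of the other
    makes their measures equal. *)
Lemma dim_of_exponent p q : dim_of p = dim_of q <-> exponent p =1 exponent q.
Proof.
split=> [/eqP|epq]; last apply/eqP; rewrite dim_of_eq.
  by case/asboolP=> a [c /(congr1 exponent)]; rewrite !exponent_scale => ->.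
apply/asboolP; exists (measure b q), (measure b p); apply: coords_inj => [|i].
  by rewrite !logm_scale addrC.
by rewrite !exponent_scale.
Qed.

(** The choice of representative is immaterial, since commensurable quantities have equal
    exponents. *)
Definition dim_exponent (d : dimension Q) := exponent (repr d).

Lemma dim_exponent_of q : dim_exponent (dim_of q) =1 exponent q.
Proof. by apply/dim_of_exponent; exact: dim_of_repr. Qed.

Lemma dim_exponentM d e i :
  dim_exponent (d * e)%g i = dim_exponent d i + dim_exponent e i.
Proof. by rewrite -exponentM -dim_exponent_of dim_ofM !dim_of_repr. Qed.

Lemma dim_exponent_inj d e : dim_exponent d =1 dim_exponent e -> d = e.
Proof. by rewrite -{2}[d]dim_of_repr -{2}[e]dim_of_repr => /dim_of_exponent. Qed.

Lemma dim_invertible (d : dimension Q) : invertible d.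
Proof.
have [q [dq qd]] := basis_invertible (repr d).
by exists (dim_of q); rewrite -[d]dim_of_repr -!dim_ofM dq qd.
Qed.

Lemma dim_exponentX (d : dimension Q) m i :
  dim_exponent (d ^+ m)%g i = dim_exponent d i *+ m.
Proof. exact: charX (fun d e => dim_exponentM d e i) _ _. Qed.

Lemma dim_exponent_prod r (B : 'I_r -> dimension Q) l i :
  dim_exponent (\prod_j (B j ^^ l j)%QS)%g i = \sum_j dim_exponent (B j) i *~ l j.
Proof.
have eM d e := dim_exponentM d e i.
rewrite (char_prod eM); apply: eq_bigr => j _.
by rewrite (char_zpow eM) //; exact: dim_invertible.
Qed.

Lemma logm_prod r (q : 'I_r -> Q) l :
  logm (\prod_j (q j ^^ l j)%QS)%g = \sum_j logm (q j) *~ l j.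
Proof.
rewrite (char_prod logmM); apply: eq_bigr => j _.
by rewrite (char_zpow logmM) //; exact: basis_invertible.
Qed.

Lemma exponent_prod r (q : 'I_r -> Q) l i :
  exponent (\prod_j (q j ^^ l j)%QS)%g i = \sum_j exponent (q j) i *~ l j.
Proof.
have eM p q' := exponentM p q' i.
rewrite (char_prod eM); apply: eq_bigr => j _.
by rewrite (char_zpow eM) //; exact: basis_invertible.
Qed.

(** Maximality speaks only of dimensions other than the [B j], and its exponent may be negative. A
    [B j] is its own expansion with [c = 1], and a negative exponent is made positive by negating
    the whole relation. *)
Lemma maximal_independent_span r (B : 'I_r -> dimension Q) T d :
  maximal_independent T B -> T d ->
  exists2 c : nat, (0 < c)%N & exists l : 'I_r -> int,
    (d ^+ c)%g = (\prod_j (B j ^^ l j)%QS)%g.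
Proof.
case=> _ _ maxB Td; have [[j ->]|dB] := pselect (exists j, d = B j).
  by exists 1%N => //; exists (fun i => (i == j)%:R); rewrite prod_zpow_delta expg1.
have [j dj|k [l [k_neq0 dk]]] := maxB d Td; first by apply: dB; exists j.
case: k => c in k_neq0 dk; first by exists c; rewrite ?lt0n //; exists l.
exists c.+1 => //; exists (fun j => - l j); apply: dim_exponent_inj => i.
rewrite dim_exponentX dim_exponent_prod.
under eq_bigr do rewrite mulrNz.
rewrite sumrN -dim_exponent_prod -dk.
rewrite (char_zpow (fun d e => dim_exponentM d e i)); last exact: dim_invertible.
by rewrite NegzE mulrNz opprK.
Qed.

Lemma exponent_quantity (d : dimension Q) (q : d) : exponent (val q) =1 dim_exponent d.
Proof. by case: q => q /= /eqP <- i; rewrite dim_exponent_of. Qed.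

(** This lets covariance constrain a representation at every scalar argument. *)
Lemma quantity_with_measure (d : dimension Q) (mu : {posnum R}) :
  exists q : d, measure b (val q) = mu.
Proof.
have qd : dim_of (expansion b mu (dim_exponent d)) == d.
  apply/eqP/dim_exponent_inj => i.
  by rewrite dim_exponent_of exponent_expansion.
by exists (exist (fun q => dim_of q == d) _ qd); rewrite measure_expansion.
Qed.

End Coordinates.

(** * Change of basis by positive scale factors *)

Section Rescaling.
Variables (R : realType) (Q : quantitySpaceType R) (n : nat) (b : 'I_n -> Q).
Hypothesis b_basis : is_basis b.
Variable x : 'I_n -> R.

Definition rescale i : Q := (expp (x i) *: b i)%QS.

Let logm_rescale mu k :
  logm b (expansion rescale mu k) = logp mu + pairing k x.
Proof.
rewrite /expansion logm_scale // (char_prod (logmM b_basis)); congr (_ + _).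
apply: eq_bigr => i _; rewrite (char_zpow (logmM b_basis)) //.
  by rewrite logm_scale // exppK logm_basis // addr0.
exact: (basis_invertible b_basis).
Qed.

Let exponent_rescale mu k : exponent b (expansion rescale mu k) = k.
Proof.
rewrite /expansion exponent_scale //; apply/ffunP => i.
have eM p q := exponentM b_basis p q i.
rewrite (char_prod eM) (bigD1 i) //= big1 => [|j /negbTE ji].
  rewrite (char_zpow eM) ?exponent_scale ?exponent_basis // ?eqxx ?intz ?addr0 //.
  exact: (basis_invertible b_basis).
rewrite (char_zpow eM) ?exponent_scale ?exponent_basis // ?(eq_sym i) ?ji ?mul0rz //.
exact: (basis_invertible b_basis).
Qed.

(** Passing from [rescale] back to [b] keeps the exponents and adds their pairing with [x] to the
    log measure. The shift determines [mu], and the coordinates over [b] give uniqueness. *)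
Lemma rescale_basis : is_basis rescale.
Proof.
split=> [i|q]; first exact: (basis_invertible b_basis).
pose mu := expp (logm b q - pairing (exponent b q) x).
have qE : q = expansion rescale mu (exponent b q).
  apply: (coords_inj b_basis) => [|i]; last by rewrite exponent_rescale.
  by rewrite logm_rescale exppK subrK.
exists (mu, exponent b q); split=> // -[nu k] /= qE'.
have ek : exponent b q = k by rewrite qE' exponent_rescale.
congr pair => //; apply: (can_inj (@logpK R)); rewrite exppK.
by rewrite ek {1}qE' logm_rescale addrK.
Qed.

(** Larger units give smaller measures, hence the minus sign. *)
Lemma logm_rescaled q : logm rescale q = logm b q - pairing (exponent b q) x.
Proof.
rewrite -{2 3}[q](expansion_coords rescale_basis).
by rewrite logm_rescale exponent_rescale addrK.
Qed.

End Rescaling.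

(** * Components of a concatenated family *)

Section Concat.
Variables (T : Type) (m r : nat) (x : 'I_m -> T) (y : 'I_r -> T).

Lemma concat_lshift i : concat x y (lshift r i) = x i.
Proof. by rewrite /concat (unsplitK (inl i)). Qed.

Lemma concat_rshift j : concat x y (rshift m j) = y j.
Proof. by rewrite /concat (unsplitK (inr j)). Qed.

End Concat.

(** * The scaling law of a covariant representation *)

Section CovariantScaling.
Variables (R : realType) (Q : quantitySpaceType R) (n : nat) (b : 'I_n -> Q).
Hypothesis b_basis : is_basis b.

(* Compare the bases [b] and [rescale b x] on quantities with measures [u]. *)
Lemma covariant_scaling N (F : 'I_N -> dimension Q) F0
    (Psi : quantity_function F F0) psi u x :
  covariant_representation Psi psi ->
  logp (psi (fun i => expp (logp (u i) - pairing (dim_exponent b (F i)) x))) =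
  logp (psi u) - pairing (dim_exponent b F0) x.
Proof.
move=> psiP.
pose y i : F i := projT1 (cid (quantity_with_measure b_basis (F i) (u i))).
have yE i : measure b (val (y i)) = u i.
  by rewrite /y; case: cid.
have pairE (d : dimension Q) (q : d) :
    pairing (exponent b (val q)) x = pairing (dim_exponent b d) x.
  by apply: eq_bigr => i _; rewrite (exponent_quantity b_basis).
(* The shifted arguments are the measures of the same quantities [y] in the rescaled basis, so
   covariance applies in both bases. *)
rewrite [X in psi X](_ : _ = fun i => measure (rescale b x) (val (y i))); last first.
  apply: funext => i; apply: (can_inj (@logpK R)); rewrite exppK.
  by rewrite -/(logm _ _) (logm_rescaled b_basis) pairE /logm yE.
rewrite (psiP _ _ (rescale_basis b_basis x)) -/(logm _ _).
rewrite (logm_rescaled b_basis) pairE /logm -(psiP _ _ b_basis).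
by congr (logp (psi _) - _); apply: funext => i.
Qed.

End CovariantScaling.

(** * Reduction to dimensionless products *)

Section Reduction.
Variables (R : realType) (Q : quantitySpaceType R) (m r n : nat) (b : 'I_n -> Q).
Hypothesis b_basis : is_basis b.
Variables (D0 : dimension Q) (D : 'I_m -> dimension Q) (B : 'I_r -> dimension Q).
Hypothesis B_independent : independent B.
Variables (c : 'I_m -> nat) (cij : 'I_m -> 'I_r -> int).
Hypothesis c_gt0 : forall i, (0 < c i)%N.
Hypothesis DcE : forall i, (D i ^+ c i)%g = (\prod_j (B j ^^ cij i j)%QS)%g.
Variables (Psi : quantity_function (concat D B) D0).
Variables (psi : ('I_(m + r) -> {posnum R}) -> {posnum R}).
Hypothesis psiP : covariant_representation Psi psi.

Let E := dim_exponent b.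

Let pairing_powE (d : dimension Q) k kj (x : 'I_n -> R) :
  (d ^+ k)%g = (\prod_j (B j ^^ kj j)%QS)%g ->
  pairing (E d) x *+ k = \sum_j pairing (E (B j)) x *~ kj j.
Proof.
move=> dE; apply: pairing_span => i.
by rewrite -(dim_exponentX b_basis) dE (dim_exponent_prod b_basis).
Qed.

Lemma value_dimension_span :
  exists2 k : nat, (0 < k)%N & exists kj : 'I_r -> int,
    (D0 ^+ k)%g = (\prod_j (B j ^^ kj j)%QS)%g.
Proof.
have D0E x : (forall j, pairing (E (B j)) x = 0) -> pairing (E D0) x = 0 :> R.
  move=> Bx; have Dx i : pairing (E (D i)) x = 0.
    apply/eqP; have /eqP := pairing_powE x (DcE i).
    by rewrite big1 => [|j _]; rewrite ?Bx ?mul0rz // mulrn_eq0 eqn0Ngt c_gt0.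
  (* At the point with all arguments 1 ([expp 0]), rescaling by such an [x] moves no argument, hence
     not the value, so the pairing with [D0] vanishes. *)
  have := covariant_scaling b_basis (fun=> expp 0) x psiP.
  rewrite [X in psi X](_ : _ = fun=> expp 0); last first.
    apply: funext => i; rewrite exppK; congr expp.
    have [j ->|j ->] := split_ordP i.
      by rewrite concat_lshift Dx subr0.
    by rewrite concat_rshift Bx subr0.
  by move/eqP; rewrite -subr_eq0 opprB addrC subrK => /eqP.
have [k k_gt0 [kj kjE]] := rational_span D0E.
exists k => //; exists kj; apply: (dim_exponent_inj b_basis) => i.
by rewrite (dim_exponentX b_basis) (dim_exponent_prod b_basis) kjE.
Qed.

Variables (k : nat) (kj : 'I_r -> int).
Hypothesis DkE : (D0 ^+ k)%g = (\prod_j (B j ^^ kj j)%QS)%g.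

Definition pi_group (u : 'I_(m + r) -> {posnum R}) (i : 'I_m) : {posnum R} :=
  ((u (lshift r i))%:num ^+ c i /
   (monomial (fun j => u (rshift m j)) (cij i))%:num)%:pos.

(** This is psi^k at normalised arguments: the positive [c i]-th root of [w i] in the first [m]
    places and 1 in the last [r]. *)
Definition reduced_representation (w : 'I_m -> {posnum R}) : {posnum R} :=
  ((psi (concat (fun i => expp (logp (w i) / (c i)%:R)) (fun=> expp 0)))%:num
     ^+ k)%:pos.

Lemma logp_pi_group u i :
  logp (pi_group u i) =
  logp (u (lshift r i)) *+ c i - \sum_j logp (u (rshift m j)) *~ cij i j.
Proof.
rewrite -logp_monomial -logpX -logpV -logpM.
by congr logp; apply: val_inj.
Qed.

(* By independence of the [B j] there is a change of basis under which every
   [u (rshift m j)] becomes [1]. *)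
Lemma reduced_representationP u :
  (psi u)%:num ^+ k =
  (monomial (fun j => u (rshift m j)) kj)%:num *
  (reduced_representation (pi_group u))%:num.
Proof.
have [x xE] : exists x, forall j, pairing (E (B j)) x = logp (u (rshift m j)).
  apply: integral_independence_solve => l l0; apply: B_independent.
  apply: (dim_exponent_inj b_basis) => i; rewrite (dim_exponent_prod b_basis) l0.
  by rewrite (char1 (fun d e => dim_exponentM b_basis d e i)).
have := covariant_scaling b_basis u x psiP.
rewrite [X in psi X](_ : _ = concat (fun i => expp (logp (pi_group u i) / (c i)%:R))
    (fun=> expp 0)); last first.
  apply: funext => i; have [j ->|j ->] := split_ordP i.
    rewrite !concat_lshift logp_pi_group; congr expp.
    (* After multiplication by [c j], the relation [DcE] turns the pairing with [D j] into the
       logarithm of the denominator of pi_j. *)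
    have cj0 : (c j)%:R != 0 :> R by rewrite pnatr_eq0 -lt0n.
    apply: (mulIf cj0); rewrite mulfVK // mulr_natr mulrnBl (pairing_powE x (DcE j)).
    by congr (_ - _); apply: eq_bigr => l _; rewrite xE.
  by rewrite !concat_rshift xE subrr.
(* Multiplying the scaling law by [k] lets [DkE] express the pairing with [D0] through the last [r]
   arguments. *)
move/(congr1 (fun y => y *+ k)); rewrite mulrnBl (pairing_powE x DkE).
under eq_bigr do rewrite xE.
rewrite -logp_monomial -!logpX => e.
transitivity (((psi u)%:num ^+ k)%:pos)%:num => //.
transitivity (((monomial (fun j => u (rshift m j)) kj)%:num *
  (reduced_representation (pi_group u))%:num)%:pos)%:num => //.
congr (_%:num); apply: (can_inj (@logpK R)).
by rewrite logpM e addrC subrK.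
Qed.

End Reduction.

(** * Assembly of the quasiscalar and scalar functions *)

Theorem theorem5 (R : realType) (Q : quantitySpaceType R) (m r : nat)
    (D0 : dimension Q) (D : 'I_m -> dimension Q) (B : 'I_r -> dimension Q)
    (hB : maximal_independent
            (generated_dimension_group (range (concat D B))) B)
    (Psi : quantity_function (concat D B) D0)
    (hPsi : ~ trivial_function Psi)
    (psi : ('I_(m + r) -> {posnum R}) -> {posnum R})
    (hpsi : covariant_representation Psi psi) :
  exists (k : nat) (kj : 'I_r -> int)
         (c : 'I_m -> nat) (cij : 'I_m -> 'I_r -> int),
    [/\ (0 < k)%N /\ (D0 ^+ k)%g = (\prod_(j < r) (B j ^^ kj j)%QS)%g,
        forall i, (0 < c i)%N /\
          (D i ^+ c i)%g = (\prod_(j < r) (B j ^^ cij i j)%QS)%g,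
        exists Phi : quasiscalar_function Q m,
          forall x : (forall i, concat D B i),
          let p (i : 'I_m) : Q := val (x (lshift r i)) in
          let q (j : 'I_r) : Q := val (x (rshift m j)) in
          exists2 Pi : forall i : 'I_m, (1%g : dimension Q),
            forall i, val (Pi i) =
              (p i ^+ c i * minv (\prod_(j < r) (q j ^^ cij i j)%QS))%g
            & val (function_pow k Psi x) =
              ((\prod_(j < r) (q j ^^ kj j)%QS) * val (Phi Pi))%g
      & exists phi : ('I_m -> {posnum R}) -> {posnum R},
          let psik (u : 'I_(m + r) -> {posnum R}) : {posnum R} :=
            let s (i : 'I_m) := u (lshift r i) in
            let t (j : 'I_r) := u (rshift m j) in
            let pi (i : 'I_m) : {posnum R} :=
              ((s i)%:num ^+ c i / (monomial t (cij i))%:num)%:pos in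
            ((monomial t kj)%:num * (phi pi)%:num)%:pos in
          (forall u, ((psi u)%:num ^+ k) = (psik u)%:num) /\
          covariant_representation (function_pow k Psi) psik].
Proof.
have [n [b b_basis]] := @finite_basis R Q.
have [_ B_indep _] := hB.
have subT : (range (concat D B) `<=` generated_dimension_group (range (concat D B)))%classic.
  exact: sub_smallest.
have Dspan i : exists cl : nat * ('I_r -> int),
    (0 < cl.1)%N /\ (D i ^+ cl.1)%g = (\prod_j (B j ^^ cl.2 j)%QS)%g.
  have [|c c_gt0 [l DiE]] := maximal_independent_span b_basis (d := D i) hB.
    by apply: subT; exists (lshift r i); rewrite ?concat_lshift.
  by exists (c, l).
have [cl clP] := choice Dspan.
pose c i := (cl i).1; pose cij i := (cl i).2.
have c_gt0 i : (0 < c i)%N by case: (clP i).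
have DcE i : (D i ^+ c i)%g = (\prod_j (B j ^^ cij i j)%QS)%g by case: (clP i).
have [k k_gt0 [kj DkE]] := value_dimension_span b_basis c_gt0 DcE hpsi.
pose phi := reduced_representation c psi k.
have psikE := reduced_representationP b_basis B_indep c_gt0 DcE hpsi DkE.
exists k, kj, c, cij; split=> //.
- have scalar_dim (a : {posnum R}) : dim_of (a *: (1%g : Q))%QS == 1%g.
    by apply/eqP/(dim_of_exponent b_basis); rewrite exponent_scale.
  (* [Phi] applies [phi] to the measures relative to the fixed basis [b] and scales the unit of [Q]
     by the result. *)
  exists (fun y => exist (fun q => dim_of q == 1%g) _
    (scalar_dim (phi (fun i => measure b (val (y i)))))) => x p q.
  have logm_p i : logm b (p i ^+ c i)%g = logm b (p i) *+ c i.
    exact: charX (logmM b_basis) _ _.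
  have pE i l : exponent b (p i) l = dim_exponent b (D i) l.
    by rewrite /p (exponent_quantity b_basis) concat_lshift.
  have qE j l : exponent b (q j) l = dim_exponent b (B j) l.
    by rewrite /q (exponent_quantity b_basis) concat_rshift.
  have exponent_prod_q e l : exponent b (\prod_j (q j ^^ e j)%QS)%g l =
      dim_exponent b (\prod_j (B j ^^ e j)%QS)%g l.
    rewrite (exponent_prod b_basis) (dim_exponent_prod b_basis).
    by apply: eq_bigr => j _; rewrite qE.
  have inv z := basis_invertible b_basis z.
  (* By [DcE], numerator and denominator have the same dimension. *)
  have Pi_dim i : dim_of (p i ^+ c i * minv (\prod_(j < r) (q j ^^ cij i j)%QS))%g == 1%g.
    apply/eqP/(dim_of_exponent b_basis) => l.
    have eM z w := exponentM b_basis z w l.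
    rewrite eM (charX eM) (char_minv eM (inv _)) (char1 eM) pE exponent_prod_q.
    by rewrite -DcE (dim_exponentX b_basis) subrr.
  pose Pi i : (1%g : dimension Q) := exist (fun q => dim_of q == 1%g) _ (Pi_dim i).
  exists Pi => //=.
  have PiE : (fun i => measure b (val (Pi i))) =
      pi_group c cij (fun i => measure b (val (x i))).
    apply: funext => i; apply: (can_inj (@logpK R)).
    rewrite logp_pi_group -/(logm _ _) /= (logmM b_basis) logm_p.
    by rewrite (char_minv (logmM b_basis) (inv _)) (logm_prod b_basis).
  (* The log measures agree by the scalar identity [psikE], the exponents by [DkE]. *)
  apply: (coords_inj b_basis) => [|l].
    rewrite (charX (logmM b_basis)) (logmM b_basis) (logm_prod b_basis).
    rewrite (logm_scale b_basis) (char1 (logmM b_basis)) addr0 PiE -logp_monomial.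
    rewrite -logpM /logm -(hpsi _ _ b_basis) -logpX; congr logp; apply: val_inj.
    exact: psikE.
  have eM z w := exponentM b_basis z w l.
  rewrite (charX eM) eM exponent_prod_q -DkE (dim_exponentX b_basis).
  by rewrite (exponent_scale b_basis) (char1 eM) addr0 (exponent_quantity b_basis).
exists phi => psik; have psikP u : (psi u)%:num ^+ k = (psik u)%:num by exact: psikE.
(* Here the basis [b'] is arbitrary: [psik] equals the [k]-th power of [psi] at all scalars, and
   measures relative to [b'] respect powers. *)
split=> // n' b' b'_basis x; apply: val_inj.
transitivity ((psi (fun i => measure b' (val (x i))))%:num ^+ k) => //.
rewrite (hpsi _ _ b'_basis) expr_num_logp -/(logm _ _) -(charX (logmM b'_basis)).
by rewrite /logm lnK // posrE.
Qed.
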